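(* Let $t\ge 3$ be an odd integer, put $s=t^2-t+1$, and let $\mathcal{X}=(X,\{R_i\}_{i=0}^{4})$ be a cometric (symmetric) $4$-class association scheme with Krein array $$\left\{(s+t)(t-1),\ \tfrac{s^2}{t},\ \tfrac{s(t-1)}{t},\ 1;\ 1,\ \tfrac{s(t-1)}{t},\ \tfrac{s^2}{t},\ (s+t)(t-1)\right\},$$ with relations labelled as specified in the context. For each pair $(x,y)\in R_2$ let $$C_{x,y}=\{x,y\}\cup\{z\in X:(x,z)\in R_2,\ (y,z)\in R_2\},\qquad C'_{x,y}=\{z\in X:(x,z)\in R_1,\ (y,z)\in R_1\},$$ and let $\mathcal{C}=\{C_{x,y}\cup C'_{x,y}:(x,y)\in R_2\}$ (a set of subsets of $X$). Then the incidence structure $\mathcal{S}=(\mathcal{C},X,{\rm I})$, whose points are the elements of $\mathcal{C}$, whose lines are the elements of $X$, and in which a point $K\in\mathcal{C}$ and a line $x\in X$ are incident if and only if $x\in K$, is a generalized quadrangle of order $(t^2,t)$. Moreover, for an arbitrarily chosen $x\in X$, the set $U=\{x\}\cup R_2(x)\cup R_4(x)$ is a hemisystem of $\mathcal{S}$.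
   Context: Generalized quadrangle: an incidence structure with disjoint nonempty finite sets $\mathcal{P}$ of points and $\mathcal{B}$ of lines and a symmetric incidence relation ${\rm I}$ is a generalized quadrangle (GQ) of order $(\sigma,\tau)$ if: (i) each point is incident with $\tau+1$ lines, and two distinct points are incident with at most one common line; (ii) each line is incident with $\sigma+1$ points, and two distinct lines are incident with at most one common point; (iii) if $p$ is a point and $L$ a line not incident with $p$, there is exactly one pair $(q,M)\in\mathcal{P}\times\mathcal{B}$ with $p\,{\rm I}\,M\,{\rm I}\,q\,{\rm I}\,L$. Hemisystem: for $t$ odd, a hemisystem of a GQ of order $(t^2,t)$ is a set $U$ of lines such that every point is incident with exactly $(t+1)/2$ lines of $U$. Association schemes: all schemes are symmetric; $R_0$ is the identity relation, $R_i(x)=\{y\in X:(x,y)\in R_i\}$, $A_i$ is the adjacency matrix of $R_i$, $E_0,\dots,E_d$ are the primitive idempotents ($E_0=\frac{1}{|X|}J$), and the Krein parameters $q_{ij}^k$ are defined by $E_i\circ E_j=\frac{1}{|X|}\sum_k q_{ij}^kE_k$ ($\circ$ is the entrywise product). The scheme is cometric ($Q$-polynomial) if the primitive idempotents can be ordered so that $q_{ij}^k\ne0$ implies $k\le i+j$, and $q_{ij}^{i+j}\neq0$, for all $i,j,k$ in range. With such an ordering, the Krein array of a $d$-class scheme is $\{b_0^*,\dots,b_{d-1}^*;c_1^*,\dots,c_d^*\}$ with $b_i^*=q^i_{1,i+1}$ and $c_i^*=q^i_{1,i-1}$. Labelling of relations: the Krein array determines all parameters of the scheme up to the labelling of the nontrivial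 relations. The relations $R_1,\dots,R_4$ are labelled so that their valencies are $$n_1=\tfrac{(t+1)(t^2+1)}2,\quad n_2=\tfrac{(t-1)(t^2+1)}2,\quad n_3=\tfrac{t^2(t^2-1)}2,\quad n_4=\tfrac{t^2(t^2+1)}2 .$$ With this labelling, and with $b=\binom{t+1}{2}$, the first eigenmatrix (row $i$, column $j$ is the eigenvalue of $A_j$ on the column space of $E_i$, $0\le i,j\le4$) is $$P=\begin{pmatrix}1&n_1&n_2&n_3&n_4\\1&b&-\frac{s+1}2&-b&\frac{s-1}2\\1&0&t-1&0&-t\\1&-b&-\frac{s+1}2&b&\frac{s-1}2\\1&-n_1&n_2&-n_3&n_4\end{pmatrix}.$$ *)

(* Defs.v *)
From HB Require Import structures.
From mathcomp Require Import all_boot all_order all_algebra.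

Set Implicit Arguments.
Unset Strict Implicit.
Unset Printing Implicit Defensive.

Import Order.TTheory GRing.Theory Num.Theory.
Local Open Scope ring_scope.

(** * Symmetric association schemes *)

Record assoc_scheme (X : finType) (d : nat) := AssocScheme {
  srel :> 'I_d.+1 -> rel X;
  srel_id : forall x y, srel ord0 x y = (x == y);
  srel_nonempty : forall i, exists x y, srel i x y;
  srel_partition : forall x y, exists! i, srel i x y;
  srel_sym : forall i, symmetric (srel i);
  srel_inter : forall i j k, exists p : nat, forall x y, srel k x y ->
    #|[set z | srel i x z && srel j z y]| = p
}.

Definition nbrs (X : finType) (d : nat) (S : assoc_scheme X d)
  (i : 'I_d.+1) (x : X) : {set X} := [set y | S i x y].

Definition has_valency (X : finType) (d : nat) (S : assoc_scheme X d)
  (i : 'I_d.+1) (n : nat) : Prop := forall x, #|nbrs S i x| = n.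

(* Matrices indexed by X are matrices of size #|X|, via [enum_val]. *)
Definition adj_mx (K : nzRingType) (X : finType) (d : nat)
  (S : assoc_scheme X d) (i : 'I_d.+1) : 'M[K]_#|X| :=
  \matrix_(a, b) (S i (enum_val a) (enum_val b))%:R.

Definition in_bose_mesner (K : nzRingType) (X : finType) (d : nat)
  (S : assoc_scheme X d) (M : 'M[K]_#|X|) : Prop :=
  exists c : 'I_d.+1 -> K, M = \sum_i c i *: adj_mx K S i.

(* The Bose-Mesner algebra is commutative, so a nonzero idempotent e is
   primitive iff the only idempotents f with e f = f are 0 and e. *)
Definition primitive_idempotent (K : nzRingType) (X : finType) (d : nat)
  (S : assoc_scheme X d) (e : 'M[K]_#|X|) : Prop :=
  [/\ in_bose_mesner S e, e != 0, e *m e = e &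
      forall f, in_bose_mesner S f -> f *m f = f -> e *m f = f ->
        f = 0 \/ f = e].

Definition idempotent_ordering (K : fieldType) (X : finType) (d : nat)
  (S : assoc_scheme X d) (E : 'I_d.+1 -> 'M[K]_#|X|) : Prop :=
  [/\ injective E,
      forall M, primitive_idempotent S M <-> exists i, M = E i &
      E ord0 = #|X|%:R^-1 *: const_mx 1].

(* q i j k is the Krein parameter q_{ij}^k. *)
Definition krein_parameters (K : fieldType) (X : finType) (d : nat)
  (E : 'I_d.+1 -> 'M[K]_#|X|) (q : 'I_d.+1 -> 'I_d.+1 -> 'I_d.+1 -> K) : Prop :=
  forall i j,
    map2_mx *%R (E i) (E j) = #|X|%:R^-1 *: \sum_k q i j k *: E k.

Definition Q_polynomial (K : fieldType) (d : nat)
  (q : 'I_d.+1 -> 'I_d.+1 -> 'I_d.+1 -> K) : Prop :=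
  (forall i j k : 'I_d.+1, q i j k != 0 -> (k <= i + j)%N) /\
  (forall i j k : 'I_d.+1, k = (i + j)%N :> nat -> q i j k != 0).

(* E is an ordering of the primitive idempotents witnessing that S is cometric,
   and q is the corresponding family of Krein parameters. *)
Definition cometric_ordering (K : fieldType) (X : finType) (d : nat)
  (S : assoc_scheme X d) (E : 'I_d.+1 -> 'M[K]_#|X|)
  (q : 'I_d.+1 -> 'I_d.+1 -> 'I_d.+1 -> K) : Prop :=
  [/\ idempotent_ordering S E, krein_parameters E q & Q_polynomial q].

(* The pair ([b*_0; ...; b*_{d-1}], [c*_1; ...; c*_d]) with
   b*_i = q_{1,i+1}^i and c*_i = q_{1,i-1}^i. *)
Definition krein_array (K : fieldType) (d : nat)
  (q : 'I_d.+1 -> 'I_d.+1 -> 'I_d.+1 -> K) : seq K * seq K :=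
  ([seq q (inord 1) (inord i.+1) (inord i) | i <- iota 0 d],
   [seq q (inord 1) (inord i.-1) (inord i) | i <- iota 1 d]).

(** * Generalized quadrangles and hemisystems *)

(* Points and lines are kept apart by typing, and the symmetric
   incidence relation is given by its restriction to P x B. *)
Definition is_GQ (P B : finType) (inc : P -> B -> bool) (sigma tau : nat)
  : Prop :=
  [/\ (0 < #|P|)%N /\ (0 < #|B|)%N,
      (forall p, #|[set L | inc p L]| = tau.+1) /\
      (forall p q, p != q -> (#|[set L | inc p L && inc q L]| <= 1)%N),
      (forall L, #|[set p | inc p L]| = sigma.+1) /\
      (forall L M, L != M -> (#|[set p | inc p L && inc p M]| <= 1)%N) &
      forall p L, ~~ inc p L ->
        exists! qM : P * B, [/\ inc p qM.2, inc qM.1 qM.2 & inc qM.1 L]].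

Definition is_hemisystem (P B : finType) (inc : P -> B -> bool) (t : nat)
  (U : {set B}) : Prop :=
  [/\ odd t, is_GQ inc (t ^ 2) t &
      forall p, #|[set L in U | inc p L]| = ((t + 1) %/ 2)%N].

(** * The incidence structure of a 4-class scheme *)

Definition Cset (X : finType) (S : assoc_scheme X 4) (x y : X) : {set X} :=
  [set x; y] :|: [set z | S (inord 2) x z && S (inord 2) y z].

Definition Cset' (X : finType) (S : assoc_scheme X 4) (x y : X) : {set X} :=
  [set z | S (inord 1) x z && S (inord 1) y z].

Definition Cfamily (X : finType) (S : assoc_scheme X 4) : {set {set X}} :=
  [set Cset S x y :|: Cset' S x y | x in [set: X], y in nbrs S (inord 2) x].

Definition Cpoint (X : finType) (S : assoc_scheme X 4) : finType :=
  {A : {set X} | A \in Cfamily S}.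

Definition Cinc (X : finType) (S : assoc_scheme X 4) (A : Cpoint S) (x : X)
  : bool := x \in val A.

(* Main.v *)
Require Import Defs.
From HB Require Import structures.
From mathcomp Require Import all_boot all_order all_algebra.
From mathcomp Require Import ring lra zify.

(* The Krein array gives a three-term recursion for the dual eigenvalues, which
   determines the eigenmatrices; the given valencies then fix the labelling.
   Two consequences are used.  First, |X| E_4 has entries 1 on R_0, R_2, R_4 and
   -1 on R_1, R_3, so X splits into two halves.  Second, E_3 + E_4 is a multiple
   of the matrix f = J + (t^2-1)I - (t+1)(A_1+A_2), so R_1 u R_2 is a strongly
   regular graph with the parameters of a GQ(t,t^2).

   As in Cameron, Goethals and Seidel, this graph is geometric.  One has
   sum_xy f(x,y)^3 = 0 and f^2 is a multiple of f, hence
   sum_abc (sum_x f(x,a) f(x,b) f(x,c))^2 = sum_xy (f^2)(x,y)^3 = 0.  So each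
   inner sum vanishes, and this says that any triangle has t-2 common neighbours.
   An edge has only t-1 of them, so an edge and its common neighbours form a
   clique of size t+1.  These cliques are the points of the quadrangle.  A clique
   on an R_1-edge is halved because p^1_12 = p^1_21. *)

Set Implicit Arguments.
Unset Strict Implicit.
Unset Printing Implicit Defensive.

Import Order.TTheory GRing.Theory Num.Theory.

(** * Quadrangles from cliques *)

Section CliqueGeometry.
Variables (X : finType) (g : rel X) (t : nat).
Hypotheses (t_ge3 : 3 <= t) (g_sym : symmetric g) (g_irr : irreflexive g).
Hypothesis common2 : forall a b, g a b -> #|[set x | g a x && g b x]| = t.-1.
Hypothesis common3 : forall a b c, g a b -> g a c -> g b c ->
  #|[set x | [&& g a x, g b x & g c x]]| = t.-2.

Definition edge_clique (a b : X) : {set X} :=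
  [set z | [|| z == a, z == b | g a z && g b z]].

Lemma adj_neq a b : g a b -> a != b.
Proof. by apply: contraTneq => ->; rewrite g_irr. Qed.

(** If u is a common neighbour of a and b, the t-2 common neighbours of a, b, u lie among the t-2
    common neighbours of a and b other than u. The two sets coincide, so u is adjacent to all the
    others. *)
Lemma edge_cliqueP a b z w : g a b ->
  z \in edge_clique a b -> w \in edge_clique a b -> z != w -> g z w.
Proof.
move=> gab; rewrite !inE.
have in_common u v : g a u && g b u -> g a v && g b v -> u != v -> g u v.
  move=> u_ab v_ab ne_uv; have /andP[gau gbu] := u_ab.
  have sub : [set x | [&& g a x, g b x & g u x]] \subset
             [set x | g a x && g b x] :\ u.
    apply/subsetP => x; rewrite !inE => /and3P[-> -> gux]; rewrite !andbT.
    by rewrite eq_sym adj_neq.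
  have /setP/(_ v) : [set x | [&& g a x, g b x & g u x]] =
                     [set x | g a x && g b x] :\ u.
    apply/eqP; rewrite eqEcard sub common3 //.
    have := cardsD1 u [set x | g a x && g b x].
    rewrite common2 // inE u_ab /=; lia.
  by rewrite !inE v_ab andbT eq_sym ne_uv => /and3P[].
case/or3P => [/eqP-> | /eqP-> | zab]; case/or3P => [/eqP-> | /eqP-> | wab] ne_zw;
  rewrite ?eqxx // in ne_zw *; last exact: in_common.
- by case/andP: wab.
- by rewrite g_sym.
- by case/andP: wab.
- by rewrite g_sym; case/andP: zab.
- by rewrite g_sym; case/andP: zab.
Qed.

Lemma card_edge_clique a b : g a b -> #|edge_clique a b| = t.+1.
Proof.
move=> gab.
have -> : edge_clique a b = a |: (b |: [set x | g a x && g b x]).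
  by apply/setP => x; rewrite !inE.
rewrite !cardsU1 !inE !g_irr andbF orbF (negbTE (adj_neq gab)) common2 //=.
by lia.
Qed.

(** By [edge_cliqueP] the left side is contained in the right, and both have t+1 elements. *)
Lemma edge_clique_eq a b z w : g a b ->
  z \in edge_clique a b -> w \in edge_clique a b -> z != w ->
  edge_clique a b = edge_clique z w.
Proof.
move=> gab zin win ne_zw; have gzw := edge_cliqueP gab zin win ne_zw.
apply/eqP; rewrite eqEcard !card_edge_clique // leqnn andbT.
apply/subsetP => v vin; rewrite inE; case: eqVneq => //= ne_vz.
case: eqVneq => //= ne_vw.
by rewrite (edge_cliqueP gab zin vin) 1?eq_sym // (edge_cliqueP gab win vin) 1?eq_sym.
Qed.

Lemma edge_clique_l a b : a \in edge_clique a b.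
Proof. by rewrite inE eqxx. Qed.

Lemma edge_clique_r a b : b \in edge_clique a b.
Proof. by rewrite inE eqxx orbT. Qed.

(** * Counting in the geometry of edge cliques *)

Hypothesis cardX : #|X| = (t + 1) * (t ^ 3 + 1).
Hypothesis g_reg : forall x, #|[set y | g x y]| = t * (t ^ 2 + 1).
(** Any presentation of the family of edge cliques; [Cfamily S], which is built from R_2-pairs
    alone, will take its place. *)
Variable P : {set {set X}}.
Hypothesis P_cliques :
  forall A, A \in P <-> exists a b, g a b /\ A = edge_clique a b.
Let point : finType := {A : {set X} | A \in P}.
Let inc (p : point) (x : X) : bool := x \in val p.

Let card_point p : #|val (p : point)| = t.+1.
Proof.
have /P_cliques[a [b [gab ->]]] := valP p; exact: card_edge_clique.
Qed.

Let point_adj p z w : inc p z -> inc p w -> z != w ->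
  g z w /\ val p = edge_clique z w.
Proof.
have /P_cliques[a [b [gab pE]]] := valP p; rewrite /inc pE => zin win ne_zw.
by split; [apply: edge_cliqueP zin win _ | apply: edge_clique_eq].
Qed.

Let edge_point_proof a b : g a b -> edge_clique a b \in P.
Proof. by move=> gab; apply/P_cliques; exists a, b. Qed.

Let edge_point a b (gab : g a b) : point :=
  exist _ (edge_clique a b) (edge_point_proof gab).

Let card_points_on2 x y : x != y -> #|[set p : point | inc p x && inc p y]| = g x y.
Proof.
move=> ne_xy; have [gxy | ngxy] := boolP (g x y).
  apply/eqP/cards1P; exists (edge_point gxy); apply/setP => p; rewrite !inE.
  apply/andP/eqP => [[px py] | ->]; last by rewrite /inc edge_clique_l edge_clique_r.
  by apply: val_inj; have [_ ->] := point_adj px py ne_xy.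
apply/eqP; rewrite cards_eq0; apply/eqP/setP => p; rewrite !inE.
by apply: contraNF ngxy => /andP[px py]; have [] := point_adj px py ne_xy.
Qed.

(** Count pairs (p, y) where the point p lies on the lines x and y, with y distinct from x. Each p
    gives t of them, and each of the t(t^2+1) neighbours y of x gives exactly one. *)
Let card_points_on x : #|[set p : point | inc p x]| = (t ^ 2).+1.
Proof.
have t_gt0 : 0 < t by lia.
apply/eqP; rewrite -(eqn_pmul2l t_gt0) -addn1 -(g_reg x); apply/eqP.
transitivity (\sum_(p : point | inc p x) #|val p :\ x|).
  rewrite -sum1dep_card big_distrr /=; apply: eq_bigr => p px.
  apply/eqP; rewrite muln1 -eqSS -(card_point p).
  by rewrite (cardsD1 x (val p)) (px : x \in val p).
rewrite -sum1dep_card.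
transitivity (\sum_(p : point | inc p x) \sum_(y | y != x) (inc p y : nat)).
  apply: eq_bigr => p px; rewrite -sum1_card -big_mkcondr /=.
  by apply: eq_bigl => y; rewrite !inE.
rewrite exchange_big /= [RHS]big_mkcond [LHS]big_mkcond /=; apply: eq_bigr => y _.
case: eqVneq => [-> | ne_yx]; first by rewrite g_irr.
have := @card_points_on2 x y; rewrite eq_sym => /(_ ne_yx).
by rewrite -sum1dep_card big_mkcondr /= => ->; case: (g x y).
Qed.

(** With two neighbours in p, x would lie in their edge clique, which is p; so the count is at most
    1. Each of the t+1 members of p has t^3 neighbours outside p, and (t+1)t^3 elements lie outside,
    so the average count is 1 and every count is 1. *)
Let card_proj p x : ~~ inc p x -> #|[set y | inc p y && g y x]| = 1.
Proof.
have le1 z : ~~ inc p z -> #|[set y | inc p y && g y z]| <= 1.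
  move=> npz; rewrite leqNgt; apply/card_gt1P => -[v [w []]].
  rewrite !inE => /andP[pv gvz] /andP[pw gwz] ne_vw.
  have [_ pE] := point_adj pv pw ne_vw; case/negP: npz.
  by rewrite /inc pE inE gvz gwz !orbT.
pose c z := #|[set y | inc p y && g y z]|.
have nbrs_in y : inc p y -> #|[set z | g y z && inc p z]| = t.
  move=> py; apply/eqP; rewrite -eqSS -(card_point p).
  rewrite (cardsD1 y (val p)) (py : y \in val p).
  rewrite eqSS; apply/eqP; apply: eq_card => z; rewrite !inE.
  case: (eqVneq z y) => [-> | ne_zy]; first by rewrite g_irr.
  apply/andP/idP => [[]// | pz]; split=> //.
  by have [] := point_adj py pz; rewrite // eq_sym.
have sum_c : \sum_(z | ~~ inc p z) c z = \sum_(z | ~~ inc p z) 1.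
  transitivity (\sum_(y | inc p y) \sum_(z | ~~ inc p z) (g y z : nat)).
    rewrite exchange_big; apply: eq_bigr => z _ /=.
    by rewrite /c -sum1dep_card big_mkcondr.
  transitivity (\sum_(y | inc p y) t ^ 3).
    apply: eq_bigr => y py; have := g_reg y.
    rewrite -(cardsID [set z | inc p z]).
    have -> : [set z | g y z] :&: [set z | inc p z] = [set z | g y z && inc p z].
      by apply/setP => z; rewrite !inE.
    rewrite nbrs_in // -big_mkcondr sum1dep_card /=.
    have -> : [set z | g y z] :\: [set z | inc p z] = [set z | ~~ inc p z && g y z].
      by apply/setP => z; rewrite !inE.
    by nia.
  have -> : \sum_(y | inc p y) t ^ 3 = t.+1 * t ^ 3.
    by rewrite sum_nat_const -(card_point p).
  have -> : \sum_(z | ~~ inc p z) 1 = #|~: val p|.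
    by rewrite -sum1_card; apply: eq_bigl => z; rewrite inE.
  by have := cardsC (val p); rewrite card_point cardX; nia.
move=> npx; have /leqif_sum : forall z, ~~ inc p z -> c z <= 1 ?= iff (c z == 1).
  by move=> z npz; split; first exact: le1.
case=> _; rewrite sum_c eqxx => /esym/forall_inP/(_ x npx)/eqP //.
Qed.

Lemma clique_GQ : is_GQ inc (t ^ 2) t.
Proof.
have X_gt0 : 0 < #|X| by rewrite cardX; lia.
have [x0 _] := card_gt0P X_gt0.
split.
- split=> //; have := card_points_on x0.
  case: (pickP (fun p : point => inc p x0)) => [p _ _ | none].
    by apply/card_gt0P; exists p.
  move/eqP; rewrite (_ : [set p | _] = set0) ?cards0 //.
    by apply/setP => p; rewrite !inE none.
- split=> [p | p q ne_pq].
    by rewrite -(card_point p); apply: eq_card => x; rewrite inE.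
  rewrite leqNgt; apply: contra ne_pq => /card_gt1P[v [w []]].
  rewrite !inE => /andP[pv qv] /andP[pw qw] ne_vw.
  have [_ pE] := point_adj pv pw ne_vw; have [_ qE] := point_adj qv qw ne_vw.
  by apply/eqP/val_inj; rewrite pE qE.
- split=> [x | x y ne_xy]; first exact: card_points_on.
  by rewrite card_points_on2 //; case: (g x y).
(* The unique neighbour y of x in p is the connecting line; it meets x in the edge clique of y and
   x. *)
move=> p x npx; have /eqP/cards1P[y yE] := card_proj npx.
have yP z : inc p z && g z x = (z == y).
  by have /setP/(_ z) := yE; rewrite !inE.
have /andP[py gyx] : inc p y && g y x by rewrite yP.
exists (edge_point gyx, y); split=> /=.
  by rewrite py /inc edge_clique_l edge_clique_r.
case=> q z [/= pz qz qx].
have ne_zx : z != x by apply: contraNneq npx => <-.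
have [gzx qE] := point_adj qz qx ne_zx.
have /eqP zy : z == y by rewrite -yP pz gzx.
by rewrite zy in qE *; congr (_, _); apply: val_inj; rewrite qE.
Qed.

End CliqueGeometry.

(** * The two halves and the hemisystem *)

Section Colour.
Variables (X : finType) (d : nat) (S : assoc_scheme X d).

(** The scheme as a single colouring of pairs. The default [ord0] is never reached, since the
    relations partition the pairs. *)
Definition colour (x y : X) : 'I_d.+1 := odflt ord0 [pick i | S i x y].

Lemma srelE i x y : S i x y = (colour x y == i).
Proof.
have [k [Sk uniq_k]] := srel_partition S x y.
rewrite /colour; case: pickP => [j Sj | /(_ k)]; last by rewrite Sk.
by rewrite -(uniq_k j Sj); apply/idP/eqP => [/uniq_k // | <-].
Qed.

Lemma colourC x y : colour x y = colour y x.
Proof. by apply/eqP; rewrite -srelE srel_sym srelE. Qed.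

Lemma colour_eq0 x y : (colour x y == ord0) = (x == y).
Proof. by rewrite -srelE srel_id. Qed.

Lemma colour_surj i : exists x y, colour x y = i.
Proof.
by have [x [y]] := srel_nonempty S i; rewrite srelE => /eqP; exists x, y.
Qed.

Lemma card_scheme_gt0 : (0 < #|X|)%N.
Proof. by have [x _] := colour_surj ord0; apply/card_gt0P; exists x. Qed.

End Colour.

Definition concurrent (X : finType) (S : assoc_scheme X 4) : rel X :=
  fun x y => S (inord 1) x y || S (inord 2) x y.

(** * How the two halves of X cut the cliques *)

Section Halves.
Variables (X : finType) (S : assoc_scheme X 4) (t : nat).
Local Notation g := (concurrent S).
Hypotheses (t_ge3 : 3 <= t) (t_odd : odd t).
Hypothesis cardX : #|X| = (t + 1) * (t ^ 3 + 1).
Hypothesis g_reg : forall x, #|[set y | g x y]| = t * (t ^ 2 + 1).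
Hypothesis common2 : forall a b, g a b -> #|[set x | g a x && g b x]| = t.-1.
Hypothesis common3 : forall a b c, g a b -> g a c -> g b c ->
  #|[set x | [&& g a x, g b x & g c x]]| = t.-2.
(** The odd colours, 1 and 3, join elements of different halves; the even ones stay within a
    half. *)
Hypothesis colour_parity : forall x y z,
  odd (colour S x y) = odd (colour S x z) (+) odd (colour S z y).

Lemma concurrent_sym : symmetric g.
Proof. by move=> x y; rewrite /concurrent !(srel_sym S _ x). Qed.

Lemma concurrent_irr : irreflexive g.
Proof.
move=> x; rewrite /concurrent !srelE (eqP (_ : colour S x x == ord0)) ?colour_eq0 //.
by rewrite -!val_eqE /= !inordK.
Qed.

Let rel1E x y : S (inord 1) x y = g x y && odd (colour S x y).
Proof.
rewrite /concurrent !srelE -!val_eqE /= !inordK //.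
by case: (colour S x y) => -[|[|[|[|[|]]]]].
Qed.

Let rel2E x y : S (inord 2) x y = g x y && ~~ odd (colour S x y).
Proof.
rewrite /concurrent !srelE -!val_eqE /= !inordK //.
by case: (colour S x y) => -[|[|[|[|[|]]]]].
Qed.

Let odd_sym x y : odd (colour S x y) = odd (colour S y x).
Proof. by rewrite colourC. Qed.

(** As a and b lie in the same half, a common neighbour is R_2-related to both or R_1-related to
    both. *)
Lemma Cset_edge_clique a b : S (inord 2) a b ->
  Cset S a b :|: Cset' S a b = edge_clique g a b.
Proof.
rewrite rel2E => /andP[_]; move/negbTE => ev_ab.
apply/setP => z; rewrite !inE -!orbA !rel1E !rel2E.
have := colour_parity a b z; rewrite ev_ab (odd_sym z b).
by case: (g a z); case: (g b z); do 2!case: (odd _) => //=; rewrite !orbF.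
Qed.

Lemma common_nbr a b : g a b -> exists2 z, g a z & g b z.
Proof.
move=> gab; have : 0 < #|[set x | g a x && g b x]| by rewrite common2 //; lia.
by case/card_gt0P => z; rewrite inE => /andP[]; exists z.
Qed.

(** For an R_1-edge a, b, a common neighbour z lies in the half of a or in that of b. This gives an
    R_2-pair inside the clique, and any two of its members generate it. *)
Lemma CfamilyP A :
  A \in Cfamily S <-> exists a b, g a b /\ A = edge_clique g a b.
Proof.
have cliqueE := edge_clique_eq t_ge3 concurrent_sym concurrent_irr common2 common3.
have rel2_in a b : S (inord 2) a b -> edge_clique g a b \in Cfamily S.
  by move=> ab; rewrite -Cset_edge_clique //; apply/imset2P; exists a b; rewrite ?inE.
split=> [/imset2P[a b _] | [a [b [gab ->]]]].
  rewrite inE => ab ->; exists a, b; split; last exact: Cset_edge_clique.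
  by rewrite /concurrent ab orbT.
have [ab | nab] := boolP (S (inord 2) a b); first exact: rel2_in.
have [z gaz gbz] := common_nbr gab.
have zin : z \in edge_clique g a b by rewrite inE gaz gbz !orbT.
have := colour_parity a b z; move: nab; rewrite rel2E gab /= negbK => ->.
rewrite (odd_sym z b).
case: (boolP (odd (colour S a z))) => [_ /= /esym odd_bz | az /= odd_bz].
  rewrite (cliqueE _ _ b z) ?edge_clique_r ?(adj_neq concurrent_irr) //.
  by apply: rel2_in; rewrite rel2E gbz odd_bz.
rewrite (cliqueE _ _ a z) ?edge_clique_l ?(adj_neq concurrent_irr) //.
by apply: rel2_in; rewrite rel2E gaz.
Qed.

(* A clique inside one half would give p^2_11 = 0; but two of any three elements
   of the clique on an R_1-pair lie in the same half. *)
Lemma Cfamily_mixed A : A \in Cfamily S ->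
  exists a b, S (inord 1) a b /\ A = edge_clique g a b.
Proof.
have cliqueE := edge_clique_eq t_ge3 concurrent_sym concurrent_irr common2 common3.
case/imset2P => y z _; rewrite inE => yz ->; rewrite Cset_edge_clique //.
have [p p_eq] := srel_inter S (inord 1) (inord 1) (inord 2).
have p_gt0 v w u : S (inord 2) v w -> S (inord 1) v u -> S (inord 1) u w -> 0 < p.
  move=> vw vu uw; rewrite -(p_eq _ _ vw).
  by apply/card_gt0P; exists u; rewrite inE vu uw.
have {p_gt0} : 0 < p.
  have [a [b ab]] := srel_nonempty S (inord 1).
  have /andP[gab odd_ab] : g a b && odd (colour S a b) by rewrite -rel1E.
  have [v gav gbv] := common_nbr gab.
  have := colour_parity a b v; rewrite odd_ab (odd_sym v b).
  case: (boolP (odd (colour S a v))) => [av /= /esym odd_bv|av /= odd_bv].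
    apply: (@p_gt0 b v a); rewrite ?rel1E ?rel2E ?gbv ?gav ?av ?odd_bv //.
    by rewrite concurrent_sym gab odd_sym.
  by apply: (@p_gt0 a v b); rewrite ?rel1E ?rel2E ?gav ?av ?gab ?gbv -?odd_bv.
rewrite -(p_eq _ _ yz) => /card_gt0P[u]; rewrite inE => /andP[yu uz].
exists y, u; split=> //.
move: yz yu uz; rewrite rel1E rel2E rel1E => /andP[gyz _] /andP[gyu _] /andP[guz _].
apply: cliqueE; rewrite ?edge_clique_l ?(adj_neq concurrent_irr) //.
by rewrite inE gyu concurrent_sym guz !orbT.
Qed.

(** Apart from a, the half of a contains the z with (a,z) in R_2 and (z,b) in R_1; apart from b, the
    other half contains the z with (b,z) in R_2 and (z,a) in R_1. Both sets have size p^1_21,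
    because (a,b) and (b,a) are in R_1. *)
Lemma half_edge_clique a b : S (inord 1) a b ->
  #|[set z in edge_clique g a b | ~~ odd (colour S a z)]| = (t + 1) %/ 2 /\
  #|[set z in edge_clique g a b | odd (colour S a z)]| = (t + 1) %/ 2.
Proof.
move=> ab; have ba : S (inord 1) b a by rewrite srel_sym.
have [p p_eq] := srel_inter S (inord 2) (inord 1) (inord 1).
have /andP[gab odd_ab] : g a b && odd (colour S a b) by rewrite -rel1E.
have caa x : odd (colour S x x) = false.
  by rewrite (eqP (_ : colour S x x == ord0)) ?colour_eq0.
have even_half : #|[set z in edge_clique g a b | ~~ odd (colour S a z)]| = p.+1.
  rewrite (_ : finset _ = a |: [set z | S (inord 2) a z && S (inord 1) z b]).
    by rewrite cardsU1 inE rel2E concurrent_irr p_eq.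
  apply/setP => z; rewrite !inE rel1E rel2E (concurrent_sym z b).
  have [-> | ne_za] := eqVneq z a; first by rewrite caa.
  have [-> | ne_zb] := eqVneq z b; first by rewrite odd_ab concurrent_irr !andbF.
  have := colour_parity a b z; rewrite odd_ab.
  by case: (g a z); case: (g b z); do 2!case: (odd _).
have odd_half : #|[set z in edge_clique g a b | odd (colour S a z)]| = p.+1.
  rewrite (_ : finset _ = b |: [set z | S (inord 2) b z && S (inord 1) z a]).
    by rewrite cardsU1 inE rel2E concurrent_irr p_eq.
  apply/setP => z; rewrite !inE rel1E rel2E (concurrent_sym z a) (odd_sym z a).
  have [-> | ne_zb] := eqVneq z b; first by rewrite odd_ab orbT.
  have [-> | ne_za] := eqVneq z a; first by rewrite caa concurrent_irr !andbF.
  have := colour_parity a b z; rewrite odd_ab (odd_sym z b).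
  by case: (g a z); case: (g b z); do 2!case: (odd _).
have := card_edge_clique t_ge3 concurrent_irr common2 gab.
rewrite -(cardsID [set z | odd (colour S a z)]).
rewrite (_ : _ :&: _ = [set z in edge_clique g a b | odd (colour S a z)]); last first.
  by apply/setP => z; rewrite !inE.
rewrite (_ : _ :\: _ = [set z in edge_clique g a b | ~~ odd (colour S a z)]); last first.
  by apply/setP => z; rewrite !inE andbC.
by rewrite odd_half even_half; lia.
Qed.

Lemma Cinc_GQ : is_GQ (@Cinc X S) (t ^ 2) t.
Proof.
exact: (clique_GQ t_ge3 concurrent_sym concurrent_irr common2 common3
          cardX g_reg CfamilyP).
Qed.

(** U is the half of X containing x, and every point is the clique of an R_1-pair, which the halves
    bisect. *)
Lemma Cinc_hemisystem x : is_hemisystem (@Cinc X S) t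
  ([set x] :|: nbrs S (inord 2) x :|: nbrs S (inord 4) x).
Proof.
split=> // [|p]; first exact: Cinc_GQ.
have [a [b [ab pE]]] := Cfamily_mixed (valP p).
have [even_half odd_half] := half_edge_clique ab.
have UE z : (z \in [set x] :|: nbrs S (inord 2) x :|: nbrs S (inord 4) x) =
            ~~ odd (colour S x z).
  rewrite !inE eq_sym -(colour_eq0 S) !srelE -!val_eqE /= !inordK //.
  by case: (colour S x z) => -[|[|[|[|[|]]]]].
case: (boolP (odd (colour S x a))) => xa; [rewrite -odd_half | rewrite -even_half];
  apply: eq_card => z; rewrite in_set UE [RHS]in_set -pE andbC /Cinc;
  by rewrite (colour_parity x z a) ?xa ?(negbTE xa) //= negbK.
Qed.

End Halves.

Local Open Scope ring_scope.

(** * Pseudo-geometric graphs are geometric *)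

(** The values are t^2 on the diagonal, -t on edges and 1 elsewhere. For the collinearity graph of a
    GQ(t,t^2) this is t(t+1)^2 times the projection onto the eigenspace of -t^2-1. *)
Definition graph_gram (K : nzRingType) (X : finType) (g : rel X) (t : nat)
    (x y : X) : K :=
  1 + (t%:R ^+ 2 - 1) * (x == y)%:R - (t%:R + 1) * (g x y)%:R.

Section PseudoGeometric.
Variables (K : rcfType) (X : finType) (g : rel X) (t : nat).
Local Notation T := (t%:R : K).
Hypotheses (t_ge3 : (3 <= t)%N) (g_sym : symmetric g) (g_irr : irreflexive g).
Hypothesis cardX : #|X| = ((t + 1) * (t ^ 3 + 1))%N.
Hypothesis g_reg : forall x, #|[set y | g x y]| = (t * (t ^ 2 + 1))%N.

Local Notation f := (@graph_gram K X g t).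

Hypothesis f_idem : forall x y, \sum_z f x z * f z y = T * (T + 1) ^+ 2 * f x y.

Lemma graph_gramC x y : f x y = f y x.
Proof. by rewrite /graph_gram eq_sym g_sym. Qed.

Lemma sum_affine x (p q r : K) :
  \sum_y (p + q * (x == y)%:R + r * (g x y)%:R) =
  p * ((T + 1) * (T ^+ 3 + 1)) + q + r * (T * (T ^+ 2 + 1)).
Proof.
rewrite !big_split /= sumr_const -!mulr_sumr -!natr_sum -[p *+ _]mulr_natr cardX.
have -> : (\sum_y (x == y) = 1)%N.
  by rewrite (bigD1 x) //= eqxx big1 // => y /negbTE ne_y; rewrite eq_sym ne_y.
have -> : (\sum_y g x y)%N = (t * (t ^ 2 + 1))%N.
  by rewrite -(g_reg x) -sum1dep_card [RHS]big_mkcond.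
by rewrite mulr1 !natrM !natrD !natrX.
Qed.

Lemma graph_gram_sum x : \sum_y f x y = 0.
Proof.
have := sum_affine x 1 (T ^+ 2 - 1) (- (T + 1)).
rewrite /graph_gram; under eq_bigr do rewrite mulNr.
by move=> ->; ring.
Qed.

(** The entrywise cube is J + (t^6-1)I - (t^3+1)A, again an affine combination. Its zero row sum is
    a vanishing Krein parameter q_kk^k of the graph. *)
Lemma graph_gram_cube x : \sum_y f x y ^+ 3 = 0.
Proof.
have := sum_affine x 1 (T ^+ 6 - 1) (- (T ^+ 3 + 1)).
rewrite [X in _ = X -> _](_ : _ = 0); last by ring.
move=> sum0; rewrite -[RHS]sum0; apply: eq_bigr => y _; rewrite /graph_gram.
by have [<- | _] := eqVneq x y; rewrite ?g_irr //; case: (g x y) => /=; ring.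
Qed.

(** Expand the square as a double sum over x and y; for fixed x, y the sum over a, b, c factors into
    three equal sums. *)
Lemma sum_sqr_triple :
  \sum_a \sum_b \sum_c (\sum_x f x a * f x b * f x c) ^+ 2 =
  \sum_x \sum_y (\sum_a f x a * f a y) ^+ 3.
Proof.
transitivity (\sum_a \sum_b \sum_c \sum_x \sum_y
    (f x a * f a y) * (f x b * f b y) * (f x c * f c y)).
  apply: eq_bigr => a _; apply: eq_bigr => b _; apply: eq_bigr => c _.
  rewrite expr2 big_distrlr /=; apply: eq_bigr => x _; apply: eq_bigr => y _.
  by rewrite (graph_gramC a) (graph_gramC b) (graph_gramC c); ring.
under eq_bigr => a _ do under eq_bigr => b _ do rewrite exchange_big /=.
under eq_bigr => a _ do rewrite exchange_big /=.
rewrite exchange_big; apply: eq_bigr => x _ /=.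
under eq_bigr => a _ do under eq_bigr => b _ do rewrite exchange_big /=.
under eq_bigr => a _ do rewrite exchange_big /=.
rewrite exchange_big; apply: eq_bigr => y _ /=.
rewrite exprSr expr2 big_distrlr /= mulr_suml; apply: eq_bigr => a _.
by rewrite mulr_suml; apply: eq_bigr => b _; rewrite mulr_sumr.
Qed.

Lemma graph_gram_triple a b c : \sum_x f x a * f x b * f x c = 0.
Proof.
have := sum_sqr_triple; rewrite [RHS]big1 => [|x _]; last first.
  under eq_bigr do rewrite f_idem exprMn.
  by rewrite -mulr_sumr graph_gram_cube mulr0.
move/eqP; rewrite psumr_eq0 => [/allP/(_ a (mem_index_enum a)) /=|? _]; last first.
  by do 2!apply: sumr_ge0 => ? _; apply: sqr_ge0.
rewrite psumr_eq0 => [/allP/(_ b (mem_index_enum b)) /=|? _]; last first.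
  by apply: sumr_ge0 => ? _; apply: sqr_ge0.
rewrite psumr_eq0 => [/allP/(_ c (mem_index_enum c)) /=|? _]; last exact: sqr_ge0.
by rewrite sqrf_eq0 => /eqP.
Qed.

Let T3 : 3 <= T. Proof. by rewrite ler_nat. Qed.
Let T1 : T + 1 != 0. Proof. by apply/negP => /eqP; have := T3; lra. Qed.

Let adjE x y : (T + 1) * (g x y)%:R = 1 + (T ^+ 2 - 1) * (x == y)%:R - f x y.
Proof. by rewrite /graph_gram; ring. Qed.

Let f_adj x y : g x y -> f x y = - T.
Proof.
move=> gxy; rewrite /graph_gram gxy.
have [eq_xy | _] := eqVneq x y; last by rewrite /=; ring.
by rewrite eq_xy g_irr in gxy.
Qed.

Let sum_delta (a : X) (c : K) : \sum_x (x == a)%:R * c = c.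
Proof.
by rewrite (bigD1 a) //= eqxx mul1r big1 ?addr0 // => x /negbTE->; rewrite mul0r.
Qed.

Let sumf a : \sum_x f x a = 0.
Proof. by under eq_bigr do rewrite graph_gramC; apply: graph_gram_sum. Qed.

Let sumff a b : \sum_x f x a * f x b = T * (T + 1) ^+ 2 * f a b.
Proof. by rewrite -f_idem; apply: eq_bigr => x _; rewrite (graph_gramC x a). Qed.

Let sum1 : \sum_(x : X) (1 : K) = (T + 1) * (T ^+ 3 + 1).
Proof. by rewrite sumr_const cardX natrM !natrD natrX. Qed.

(** By [adjE], (t+1)A is an affine expression in f, so the count reduces to the known sums of f and
    of products of two entries of f. *)
Lemma card_common_nbrs a b : g a b -> #|[set x | g a x && g b x]| = t.-1.
Proof.
move=> gab; have fab := f_adj gab.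
have ne_ab : a != b by apply: contraTneq gab => ->; rewrite g_irr.
(* At x = a the diagonal term t^2-1 of one factor meets the other factor, which is 1 - f(a,b) = 1 +
   t; likewise at x = b. *)
have nbE : (T + 1) ^+ 2 * #|[set x | g a x && g b x]|%:R = \sum_x
   (1 - f x a - f x b + f x a * f x b + (x == a)%:R * ((T ^+ 2 - 1) * (1 + T))
    + (x == b)%:R * ((T ^+ 2 - 1) * (1 + T))).
  rewrite -sum1dep_card natr_sum big_mkcond mulr_sumr /=; apply: eq_bigr => x _.
  transitivity (((T + 1) * (g x a)%:R) * ((T + 1) * (g x b)%:R)).
    rewrite (g_sym a) (g_sym b).
    by case: (g x a); case: (g x b) => /=; ring.
  rewrite !adjE; have [-> | _] := eqVneq x a.
    by rewrite (negbTE ne_ab) fab /=; ring.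
  by have [-> | _] := eqVneq x b; rewrite /= ?(graph_gramC b) ?fab; ring.
rewrite !big_split /= !sumrN !sumf !sum_delta sumff sum1 fab in nbE.
have T12 : (T + 1) ^+ 2 != 0 by rewrite expf_neq0.
apply/eqP; rewrite -(eqr_nat K); apply/eqP; apply: (mulfI T12); rewrite nbE.
by rewrite -subn1 natrB ?(leq_trans _ t_ge3) //; ring.
Qed.

(** The same expansion with three factors; the new cubic term is zero by [graph_gram_triple]. *)
Lemma card_common_nbrs3 a b c : g a b -> g a c -> g b c ->
  #|[set x | [&& g a x, g b x & g c x]]| = t.-2.
Proof.
move=> gab gac gbc; have fab := f_adj gab; have fac := f_adj gac; have fbc := f_adj gbc.
have ne v w : g v w -> (v == w) = false.
  by move=> gvw; apply: contraTF gvw => /eqP ->; rewrite g_irr.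
pose d : K := (T ^+ 2 - 1) * (1 + T) ^+ 2.
have nbE : (T + 1) ^+ 3 * #|[set x | [&& g a x, g b x & g c x]]|%:R = \sum_x
   (1 - f x a - f x b - f x c + f x a * f x b + f x a * f x c + f x b * f x c
    - f x a * f x b * f x c + (x == a)%:R * d + (x == b)%:R * d + (x == c)%:R * d).
  rewrite -sum1dep_card natr_sum big_mkcond mulr_sumr /=; apply: eq_bigr => x _.
  transitivity (((T + 1) * (g x a)%:R) * ((T + 1) * (g x b)%:R) * ((T + 1) * (g x c)%:R)).
    rewrite (g_sym a) (g_sym b) (g_sym c).
    by case: (g x a); case: (g x b); case: (g x c) => /=; ring.
  rewrite !adjE /d; have [-> | _] := eqVneq x a.
    by rewrite (ne a b) // (ne a c) // fab fac /=; ring.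
  have [-> | _] := eqVneq x b.
    by rewrite (ne b c) // (graph_gramC b a) fab fbc /=; ring.
  by have [-> | _] := eqVneq x c; rewrite /= ?(graph_gramC c) ?fac ?fbc; ring.
rewrite !big_split /= !sumrN !sumf !sum_delta !sumff in nbE.
rewrite graph_gram_triple sum1 fab fac fbc in nbE.
have T13 : (T + 1) ^+ 3 != 0 by rewrite expf_neq0.
apply/eqP; rewrite -(eqr_nat K); apply/eqP; apply: (mulfI T13); rewrite nbE /d.
by rewrite -subn2 natrB ?(leq_trans _ t_ge3) //; ring.
Qed.

End PseudoGeometric.

(** * Idempotents and Krein parameters *)

Section BoseMesner.
Variables (X : finType) (d : nat) (S : assoc_scheme X d).
Local Notation colour := (colour S).

Lemma sum_colour (V : nmodType) (F : 'I_d.+1 -> V) x :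
  \sum_y F (colour x y) = \sum_i F i *+ #|nbrs S i x|.
Proof.
rewrite (partition_big (colour x) xpredT) //=; apply: eq_bigr => i _.
rewrite (eq_bigr (fun=> F i)) => [|y /eqP -> //].
by rewrite sumr_const; congr (_ *+ _); apply: eq_card => y; rewrite !inE srelE.
Qed.

(** Grouping z by its pair of colours turns the sum into one weighted by intersection numbers, which
    depend only on the colour of (x,y). *)
Lemma sum_colour2 (V : nmodType) (F : 'I_d.+1 -> 'I_d.+1 -> V) x y x' y' :
    colour x y = colour x' y' ->
  \sum_z F (colour x z) (colour z y) = \sum_z F (colour x' z) (colour z y').
Proof.
move=> eq_c.
have sumE u v : \sum_z F (colour u z) (colour z v)
   = \sum_(k : 'I_d.+1 * 'I_d.+1) F k.1 k.2 *+ #|[set z | S k.1 u z && S k.2 z v]|.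
  rewrite (partition_big (fun z => (colour u z, colour z v)) xpredT) //=.
  apply: eq_bigr => -[i j] _ /=.
  rewrite (eq_bigr (fun=> F i j)) => [|z /eqP[-> ->] //].
  by rewrite sumr_const; congr (_ *+ _); apply: eq_card => z; rewrite !inE !srelE.
rewrite !sumE; apply: eq_bigr => -[i j] _ /=; congr (_ *+ _).
have [p Hp] := srel_inter S i j (colour x y).
by rewrite !Hp // ?srelE // eq_c.
Qed.

Variable K : rcfType.
Implicit Types M N : 'M[K]_#|X|.

Definition entry M (x y : X) : K := M (enum_rank x) (enum_rank y).

Lemma entryP M N : (forall x y, entry M x y = entry N x y) -> M = N.
Proof.
move=> eqMN; apply/matrixP => a b.
by have := eqMN (enum_val a) (enum_val b); rewrite /entry !enum_valK.
Qed.

Lemma entry_mul M N x y :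
  entry (M *m N) x y = \sum_z entry M x z * entry N z y.
Proof.
by rewrite /entry mxE (reindex enum_rank) //; apply: onW_bij; apply: enum_rank_bij.
Qed.

Lemma entry1 x y : entry 1%:M x y = (x == y)%:R.
Proof. by rewrite /entry mxE (inj_eq enum_rank_inj). Qed.

Lemma entry_sum (I : finType) (F : I -> 'M[K]_#|X|) x y :
  entry (\sum_i F i) x y = \sum_i entry (F i) x y.
Proof. by rewrite /entry summxE. Qed.

Lemma entry_scale a M x y : entry (a *: M) x y = a * entry M x y.
Proof. by rewrite /entry mxE. Qed.

Lemma in_bose_mesnerP M :
  in_bose_mesner S M <->
  exists c : 'I_d.+1 -> K, forall x y, entry M x y = c (colour x y).
Proof.
have adjE (c : 'I_d.+1 -> K) x y :
    entry (\sum_i c i *: adj_mx K S i) x y = c (colour x y).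
  rewrite entry_sum (bigD1 (colour x y)) //= entry_scale /entry mxE !enum_rankK.
  rewrite srelE eqxx mulr1 big1 ?addr0 // => i ne_i.
  by rewrite !mxE !enum_rankK srelE eq_sym (negbTE ne_i) mulr0.
split=> [[c ->] | [c Mc]]; first by exists c.
by exists c; apply: entryP => x y; rewrite Mc adjE.
Qed.

Lemma bose_mesner_sym M : in_bose_mesner S M -> M^T = M.
Proof.
case/in_bose_mesnerP => c Mc; apply: entryP => x y.
by rewrite [LHS]mxE -/(entry M y x) !Mc colourC.
Qed.

Lemma bose_mesner_mul M N :
  in_bose_mesner S M -> in_bose_mesner S N -> in_bose_mesner S (M *m N).
Proof.
case/in_bose_mesnerP => a Ma /in_bose_mesnerP[b Nb]; apply/in_bose_mesnerP.
suff /fin_all_exists[c Hc] : forall k, exists v,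
    forall x y, colour x y = k -> entry (M *m N) x y = v.
  by exists c => x y; apply: Hc.
move=> k; have [x0 [y0 c0]] := colour_surj S k.
exists (entry (M *m N) x0 y0) => x y cxy.
rewrite !entry_mul.
under eq_bigr do rewrite Ma Nb.
under [RHS]eq_bigr do rewrite Ma Nb.
by apply: (sum_colour2 (fun i j => a i * b j)); rewrite c0.
Qed.

(** The product lies in the algebra, hence is symmetric, and transposing it reverses the factors. *)
Lemma bose_mesner_comm M N :
  in_bose_mesner S M -> in_bose_mesner S N -> M *m N = N *m M.
Proof.
move=> bM bN; rewrite -[LHS](bose_mesner_sym (bose_mesner_mul bM bN)) trmx_mul.
by rewrite !bose_mesner_sym.
Qed.

(** * Primitive idempotents as a basis of the Bose-Mesner algebra *)

Section Idempotents.
Variable E : 'I_d.+1 -> 'M[K]_#|X|.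
Hypothesis E_ord : idempotent_ordering S E.

Let E_prim i : primitive_idempotent S (E i).
Proof. by case: E_ord => _ prim _; apply/prim; exists i. Qed.

Lemma idempotent_bose_mesner i : in_bose_mesner S (E i).
Proof. by case: (E_prim i). Qed.

Lemma idempotent_neq0 i : E i != 0.
Proof. by case: (E_prim i). Qed.

(** The product is an idempotent below both factors; were it nonzero, primitivity would make it
    equal to each. *)
Lemma idempotent_mul i j : E i *m E j = if i == j then E i else 0.
Proof.
have [_ _ idE minE] := E_prim i; have [_ _ idE' minE'] := E_prim j.
have [<- // | ne_ij] := eqVneq i j.
have bi := idempotent_bose_mesner i; have bj := idempotent_bose_mesner j.
have cEE := bose_mesner_comm bi bj.
have bEE := bose_mesner_mul bi bj.
have idEE : E i *m E j *m (E i *m E j) = E i *m E j.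
  by rewrite {2}cEE mulmxA -(mulmxA (E i)) idE' -mulmxA -cEE mulmxA idE.
have := minE _ bEE idEE; rewrite mulmxA idE => /(_ erefl)[// | eq_i].
have := minE' _ bEE idEE; rewrite cEE mulmxA idE' => /(_ erefl)[// | eq_j].
have [injE _ _] := E_ord.
by case/eqP: ne_ij; apply: injE; rewrite -[LHS]eq_i -[RHS]eq_j.
Qed.

Lemma idempotent_coef (c : 'I_d.+1 -> K) k :
  (\sum_i c i *: E i) *m E k = c k *: E k.
Proof.
rewrite mulmx_suml (bigD1 k) //= -scalemxAl idempotent_mul eqxx big1 ?addr0 //.
by move=> i ne_i; rewrite -scalemxAl idempotent_mul (negbTE ne_i) scaler0.
Qed.

Lemma idempotent_free (a b : 'I_d.+1 -> K) :
  \sum_i a i *: E i = \sum_i b i *: E i -> a =1 b.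
Proof.
move=> eq_ab k; have := idempotent_coef a k.
rewrite eq_ab idempotent_coef => /eqP; rewrite -subr_eq0 -scalerBl scaler_eq0.
by rewrite (negbTE (idempotent_neq0 k)) orbF subr_eq0 => /eqP.
Qed.

(** The d+1 idempotents are independent in an algebra of dimension d+1, so the square matrix [D] of
    their values on the relations is invertible. *)
Lemma idempotent_span M : in_bose_mesner S M ->
  exists c : 'I_d.+1 -> K, M = \sum_i c i *: E i.
Proof.
move/in_bose_mesnerP => [m Mm].
have /fin_all_exists[e Ee] : forall i, exists e : 'I_d.+1 -> K,
    forall x y, entry (E i) x y = e (colour x y).
  by move=> i; apply/in_bose_mesnerP/idempotent_bose_mesner.
pose D := \matrix_(i, j) e i j.
have comb (v : 'rV_d.+1) x y :
    entry (\sum_i v 0 i *: E i) x y = (v *m D) 0 (colour x y).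
  by rewrite entry_sum mxE; apply: eq_bigr => i _; rewrite entry_scale Ee mxE.
have D_unit : D \in unitmx.
  rewrite -row_free_unit -kermx_eq0; apply/rowV0P => v /sub_kermxP vD.
  have v0 : (fun i => v 0 i) =1 fun=> 0.
    apply: idempotent_free; rewrite [RHS]big1 => [|i _]; last by rewrite scale0r.
    by apply: entryP => x y; rewrite comb vD /entry !mxE.
  by apply/rowP => i; rewrite mxE; apply: v0.
pose v := \row_j m j *m invmx D.
exists (fun i => v 0 i); apply: entryP => x y.
by rewrite comb mulmxKV // mxE Mm.
Qed.

Lemma idempotent_sum1 : \sum_i E i = 1%:M.
Proof.
have [|c cE] := @idempotent_span 1%:M.
  apply/in_bose_mesnerP; exists (fun i => (i == ord0)%:R) => x y.
  by rewrite entry1 colour_eq0.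
rewrite cE; apply: eq_bigr => k _; have := idempotent_coef c k.
by rewrite -cE mul1mx => {1}->.
Qed.

End Idempotents.

End BoseMesner.

(** * Dual eigenvalues and identities for Krein parameters *)

Section Krein.
Variables (X : finType) (d : nat) (S : assoc_scheme X d) (K : rcfType).
Variable E : 'I_d.+1 -> 'M[K]_#|X|.
Hypothesis E_ord : idempotent_ordering S E.
Local Notation n := (#|X|%:R : K).

(** [u i j] is the entry Q_ji of the second eigenmatrix. *)
Definition dual_eigenvalues (u : 'I_d.+1 -> 'I_d.+1 -> K) :=
  forall i x y, entry (E i) x y = n^-1 * u i (colour S x y).

Lemma card_scheme_neq0 : n != 0.
Proof. by rewrite pnatr_eq0 -lt0n (card_scheme_gt0 S). Qed.

Lemma dual_eigenvalues_exist : exists u, dual_eigenvalues u.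
Proof.
suff /fin_all_exists[u Hu] : forall i, exists u : 'I_d.+1 -> K,
  forall x y, entry (E i) x y = n^-1 * u (colour S x y) by exists u.
move=> i; have /in_bose_mesnerP[e Ee] := idempotent_bose_mesner E_ord i.
by exists (fun j => n * e j) => x y; rewrite mulKf ?card_scheme_neq0 ?Ee.
Qed.

Variable u : 'I_d.+1 -> 'I_d.+1 -> K.
Hypothesis uE : dual_eigenvalues u.

Lemma dual_eigenvalue_entry i x y : u i (colour S x y) = n * entry (E i) x y.
Proof. by rewrite uE mulVKf ?card_scheme_neq0. Qed.

Lemma dual_eigenvalue0 j : u ord0 j = 1.
Proof.
have [x [y <-]] := colour_surj S j; rewrite dual_eigenvalue_entry.
by have [_ _ ->] := E_ord; rewrite /entry !mxE mulr1 divff ?card_scheme_neq0.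
Qed.

Lemma dual_eigenvalue_mul i j x y :
  \sum_z u i (colour S x z) * u j (colour S z y) =
  if i == j then n * u i (colour S x y) else 0.
Proof.
have nz := card_scheme_neq0.
under eq_bigr => z _ do rewrite !dual_eigenvalue_entry mulrACA.
rewrite -mulr_sumr -entry_mul (idempotent_mul E_ord).
case: ifP => _; first by rewrite dual_eigenvalue_entry mulrA.
by rewrite /entry mxE mulr0.
Qed.

Lemma dual_eigenvalue_sum i x :
  i != ord0 -> \sum_j u i j *+ #|nbrs S j x| = 0.
Proof.
move=> i0; rewrite -sum_colour.
have := dual_eigenvalue_mul i ord0 x x; rewrite (negbTE i0) => mul0; rewrite -[RHS]mul0.
by apply: eq_bigr => z _; rewrite dual_eigenvalue0 mulr1.
Qed.

(** The adjacency matrix of R_j is a combination of the idempotents, so they cannot all agree on R_j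
    and another relation. *)
Lemma dual_eigenvalue_inj j k : (forall i, u i j = u i k) -> j = k.
Proof.
move=> eq_u.
have /(idempotent_span E_ord)[c cE] : in_bose_mesner S (adj_mx K S j).
  apply/in_bose_mesnerP; exists (fun i => (i == j)%:R) => x y.
  by rewrite /entry mxE !enum_rankK srelE.
have adjE x y : \sum_i c i * (n^-1 * u i (colour S x y)) = (colour S x y == j)%:R.
  rewrite -srelE.
  rewrite -[S j x y](_ : S j (enum_val (enum_rank x)) (enum_val (enum_rank y)) = _).
    transitivity (entry (adj_mx K S j) x y); last by rewrite /entry mxE.
    by rewrite cE entry_sum; apply: eq_bigr => i _; rewrite entry_scale uE.
  by rewrite !enum_rankK.
have [x [y xy]] := colour_surj S j; have [z [w zw]] := colour_surj S k.
have := adjE x y; rewrite xy eqxx; under eq_bigr => i _ do rewrite eq_u.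
rewrite -zw adjE zw; case: eqP => // _ /eqP.
by rewrite eq_sym oner_eq0.
Qed.

Variable q : 'I_d.+1 -> 'I_d.+1 -> 'I_d.+1 -> K.
Hypothesis qE : krein_parameters E q.

Lemma krein_product i j k : u i k * u j k = \sum_l q i j l * u l k.
Proof.
have nz := card_scheme_neq0.
have [x [y <-]] := colour_surj S k.
transitivity (n * (n * entry (map2_mx *%R (E i) (E j)) x y)).
  have -> : entry (map2_mx *%R (E i) (E j)) x y =
            entry (E i) x y * entry (E j) x y by rewrite [LHS]mxE.
  by rewrite !dual_eigenvalue_entry; ring.
rewrite qE entry_scale mulVKf // entry_sum mulr_sumr; apply: eq_bigr => l _.
by rewrite entry_scale dual_eigenvalue_entry mulrCA.
Qed.

Lemma krein_right0 i k : q i ord0 k = (k == i)%:R.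
Proof.
apply: (idempotent_free E_ord (a := q i ord0) (b := fun k => (k == i)%:R)).
transitivity (E i); last first.
  by rewrite (bigD1 i) //= eqxx scale1r big1 ?addr0 // => l /negbTE->; rewrite scale0r.
apply: entryP => x y; rewrite entry_sum [RHS]uE.
under eq_bigr => l _ do rewrite entry_scale uE mulrCA.
by rewrite -mulr_sumr -krein_product dual_eigenvalue0 mulr1.
Qed.

(** The idempotents sum to I, and the entrywise product of E_i with I is a multiple of I. This
    recovers the diagonal parameters q_1k^k, which the Krein array omits. *)
Lemma krein_sum i k : \sum_j q i j k = u i ord0.
Proof.
apply: (idempotent_free E_ord (a := fun k => \sum_j q i j k) (b := fun=> u i ord0)).
rewrite -scaler_sumr (idempotent_sum1 E_ord).
under eq_bigr => l _ do rewrite scaler_suml.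
rewrite exchange_big /=; apply: entryP => x y.
have nz := card_scheme_neq0.
rewrite entry_sum entry_scale entry1.
under eq_bigr => j _.
  rewrite entry_sum.
  under eq_bigr => l _ do rewrite entry_scale uE mulrCA.
  rewrite -mulr_sumr -krein_product mulrCA -uE.
  over.
rewrite -mulr_sumr -entry_sum (idempotent_sum1 E_ord) entry1 -(colour_eq0 S).
by case: eqP => [-> // | _]; rewrite !mulr0.
Qed.

(** Equal to the trace of E_k, that is, its multiplicity; as a sum of squares it is visibly
    nonzero. *)
Definition frobenius_sq k := \sum_x \sum_y entry (E k) x y ^+ 2.

Lemma frobenius_sq_neq0 k : frobenius_sq k != 0.
Proof.
have sq0 x y : 0 <= entry (E k) x y ^+ 2 by apply: sqr_ge0.
apply/eqP => /eqP; rewrite psumr_eq0 => [/allP E0|x _]; last exact: sumr_ge0.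
case/eqP: (idempotent_neq0 E_ord k); apply: entryP => x y.
have /E0 /= := mem_index_enum x.
rewrite psumr_eq0 => // /allP/(_ y (mem_index_enum y)) /=.
by rewrite sqrf_eq0 => /eqP->; rewrite /entry mxE.
Qed.

(** Up to the factor 1/|X|, both sides are the sum of all entries of the entrywise product of E_i,
    E_j and E_k. *)
Lemma krein_sym i j k : q i j k * frobenius_sq k = q i k j * frobenius_sq j.
Proof.
have dot l m : \sum_x \sum_y entry (E l) x y * entry (E m) x y =
    if l == m then frobenius_sq m else 0.
  have [-> | ne_lm] := eqVneq l m.
    by apply: eq_bigr => x _; apply: eq_bigr => y _; rewrite expr2.
  apply: big1 => x _; transitivity (entry (E l *m E m) x x).
    by rewrite entry_mul; apply: eq_bigr => y _; rewrite !uE (colourC _ y).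
  by rewrite (idempotent_mul E_ord) (negbTE ne_lm) /entry mxE.
have tri a b c : \sum_x \sum_y
    entry (E a) x y * entry (E b) x y * entry (E c) x y =
    n^-1 * (q a b c * frobenius_sq c).
  transitivity (\sum_l n^-1 * (q a b l *
      \sum_x \sum_y entry (E l) x y * entry (E c) x y)).
    under [RHS]eq_bigr => l _ do rewrite mulrA mulr_sumr.
    rewrite [RHS]exchange_big; apply: eq_bigr => x _ /=.
    under [RHS]eq_bigr => l _ do rewrite mulr_sumr.
    rewrite [RHS]exchange_big; apply: eq_bigr => y _ /=.
    have -> : entry (E a) x y * entry (E b) x y =
              entry (map2_mx *%R (E a) (E b)) x y by rewrite [RHS]mxE.
    rewrite qE entry_scale entry_sum mulr_sumr mulr_suml.
    by apply: eq_bigr => l _; rewrite entry_scale !mulrA.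
  rewrite (bigD1 c) //= dot eqxx big1 ?addr0 // => l ne_l.
  by rewrite dot (negbTE ne_l) !mulr0.
have nz := card_scheme_neq0.
have inz : n^-1 != 0 by rewrite invr_eq0.
apply: (mulfI inz); rewrite -!tri; apply: eq_bigr => x _; apply: eq_bigr => y _.
by rewrite mulrAC.
Qed.

(** The Q-polynomial condition gives q_1j^k = 0 for k > j+1; this carries it over to k < j-1. *)
Lemma krein_eq0_sym i j k : q i k j = 0 -> q i j k = 0.
Proof.
move=> q0; have /eqP := krein_sym i j k.
by rewrite q0 mul0r mulf_eq0 (negbTE (frobenius_sq_neq0 k)) orbF => /eqP.
Qed.

End Krein.

(** * Parameters of the four-class scheme *)

(* dual_root T k is the value of |X| E_1 on R_k. *)
Definition dual_root (K : fieldType) (T : K) (k : nat) : K :=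
  nth 0 [:: (T ^+ 2 + 1) * (T - 1); T * (T - 1); - (T ^+ 2 - T + 2);
            - (T ^+ 2 + 1) / T; (T - 1) ^+ 2 / T] k.

(** The first three equations make u2, u3, u4 polynomials in h; the last becomes a quintic in h with
    the roots [dual_root T k]. *)
Lemma krein_recursion_roots (K : rcfType) (T s m h u2 u3 u4 : K) :
    3 <= T -> s = T ^+ 2 - T + 1 -> m = (s + T) * (T - 1) ->
    h * h = m + (m - 1 - s ^+ 2 / T) * h + s * (T - 1) / T * u2 ->
    h * u2 = s ^+ 2 / T * h + (m - s * (T - 1) / T - s * (T - 1) / T) * u2
             + s ^+ 2 / T * u3 ->
    h * u3 = s * (T - 1) / T * u2 + (m - 1 - s ^+ 2 / T) * u3
             + m * u4 ->
    h * u4 = u3 ->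
  exists k : 'I_5, h = dual_root T k /\ u4 = (-1) ^+ k.
Proof.
move=> T3 s_def m_def e1 e2 e3 e4.
have T0 : T != 0 by apply/negP => /eqP; lra.
have T1 : T - 1 != 0 by apply/negP => /eqP; lra.
have s0 : s != 0 by apply/negP => /eqP; nra.
have sT0 : s + T != 0 by apply/negP => /eqP; nra.
have u2E : u2 = (h * h - m - (m - 1 - s ^+ 2 / T) * h) * T / (s * (T - 1)).
  by rewrite e1; field; rewrite T0 T1 s0.
have u3E : u3 = (h * u2 - s ^+ 2 / T * h
              - (m - s * (T - 1) / T - s * (T - 1) / T) * u2) * T / s ^+ 2.
  by rewrite e2; field; rewrite T0 s0.
have u4E : u4 = (h * u3 - s * (T - 1) / T * u2
              - (m - 1 - s ^+ 2 / T) * u3) / m.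
  by rewrite e3 m_def; field; rewrite T0 T1 sT0.
have s0' : T ^+ 2 - T + 1 != 0 by rewrite -s_def.
have sT0' : T ^+ 2 - T + 1 + T != 0 by rewrite -s_def.
have r0 : dual_root T 0 = m by rewrite /dual_root /= m_def s_def; ring.
have r2 : dual_root T 2 = - (s + 1) by rewrite /dual_root /= s_def; ring.
(* The factor in front is c*_2 c*_3 c*_4, which makes the quintic monic. *)
have : \prod_(k < 5) (h - dual_root T k)
     = s * (T - 1) / T * (s ^+ 2 / T) * m * (h * u4 - u3).
  rewrite !big_ord_recl big_ord0 /= r0 r2 /dual_root /=.
  by rewrite u4E u3E u2E m_def s_def; field; rewrite T0 T1 s0' sT0'.
rewrite e4 subrr mulr0 => /eqP/prodf_eq0[k _]; rewrite subr_eq0 => /eqP hk.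
exists k; split=> //; rewrite u4E u3E u2E {}hk.
rewrite m_def s_def /dual_root {r0 r2}.
by case: k => -[|[|[|[|[|]]]]] //= _; field; rewrite T0 T1 s0' sT0'.
Qed.

Lemma sum_ord5 (V : nmodType) (F : 'I_5 -> V) :
  \sum_i F i = F (inord 0) + (F (inord 1) + (F (inord 2) + (F (inord 3) + F (inord 4)))).
Proof.
rewrite !big_ord_recl big_ord0 addr0.
by do !congr (_ + _); congr F; apply: val_inj; rewrite /= inordK.
Qed.

Lemma natr_half (K : numFieldType) (n : nat) :
  ~~ odd n -> (n %/ 2)%N%:R = n%:R / 2 :> K.
Proof.
rewrite -dvdn2 => n_even; rewrite -{2}(divnK n_even) natrM mulfK //.
by rewrite pnatr_eq0.
Qed.

Definition class_valency (K : fieldType) (T : K) (k : nat) : K :=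
  nth 0 [:: 1; (T + 1) * (T ^+ 2 + 1) / 2; (T - 1) * (T ^+ 2 + 1) / 2;
            T ^+ 2 * (T ^+ 2 - 1) / 2; T ^+ 2 * (T ^+ 2 + 1) / 2] k.
Arguments class_valency : simpl never.
Arguments dual_root : simpl never.

(** The valencies are ordered n_0 < n_2 < n_1 < n_3 < n_4. *)
Lemma class_valency_inj (K : rcfType) (T : K) : 3 <= T ->
  injective (fun k : 'I_5 => class_valency T k).
Proof.
move=> T3.
have lts : [/\ 1 < class_valency T 2, class_valency T 2 < class_valency T 1,
    class_valency T 1 < class_valency T 3 & class_valency T 3 < class_valency T 4].
  by rewrite /class_valency /=; split; nra.
case: lts; have : class_valency T 0 = 1 by [].
move=> v0 v2 v1 v3 v4 [j lt_j] [k lt_k] /= eq_v; apply: val_inj => /=.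
move: eq_v; case: j lt_j => [|[|[|[|[|]]]]] // _;
  case: k lt_k => [|[|[|[|[|]]]]] // _ // eq_v; exfalso; lra.
Qed.

(* N k is the valency of the relation on which |X| E_1 takes the value
   dual_root T k; the last three hypotheses say that E_1, E_4 and E_3 have zero
   row sums. *)
Lemma class_valency_solve (K : rcfType) (T : K) (N : 'I_5 -> K) : 3 <= T ->
    N (inord 0) = 1 -> \sum_k N k = (T + 1) * (T ^+ 3 + 1) ->
    \sum_k N k * dual_root T k = 0 -> \sum_k N k * (-1) ^+ k = 0 ->
    \sum_k N k * (dual_root T k * (-1) ^+ k) = 0 ->
  forall k : 'I_5, N k = class_valency T k.
Proof.
move=> T3; rewrite !sum_ord5 !inordK // => N0; rewrite N0.
have T0 : T != 0 by apply/negP => /eqP; lra.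
have d13 : dual_root T 1 - dual_root T 3 != 0.
  suff: 0 < dual_root T 1 - dual_root T 3 by rewrite lt0r => /andP[].
  rewrite /dual_root /= mulNr opprK ltr_pwDl ?divr_ge0 ?mulr_gt0 //; nra.
have d42 : dual_root T 4 - dual_root T 2 != 0.
  suff: 0 < dual_root T 4 - dual_root T 2 by rewrite lt0r => /andP[].
  rewrite /dual_root /= opprK ltr_wpDl ?divr_ge0 //; nra.
rewrite -!(signr_odd _ 4) -!(signr_odd _ 3) -!(signr_odd _ 2) /= !expr0 !expr1.
set a1 := dual_root T 1 in d13 *; set a3 := dual_root T 3 in d13 *.
set a2 := dual_root T 2 in d42 *; set a4 := dual_root T 4 in d42 *.
set N1 := N (inord 1); set N2 := N (inord 2).
set N3 := N (inord 3); set N4 := N (inord 4).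
move=> e0 e1 e2 e3.
(* Adding and subtracting the hypotheses separates odd from even k, leaving two 2 by 2 systems with
   determinants [d13] and [d42] up to sign. *)
have odd_sum : N1 + N3 = (T + 1) * (T ^+ 3 + 1) / 2 by lra.
have even_sum : N2 + N4 = (T + 1) * (T ^+ 3 + 1) / 2 - 1 by lra.
have odd_root : N1 * a1 + N3 * a3 = 0 by lra.
have even_root : N2 * a2 + N4 * a4 = - dual_root T 0 by lra.
have N1E : N1 = class_valency T 1.
  apply: (mulIf d13); transitivity (N1 * a1 + N3 * a3 - (N1 + N3) * a3); first by ring.
  by rewrite odd_root odd_sum /a1 /a3 /class_valency /dual_root /=; field.
have N4E : N4 = class_valency T 4.
  apply: (mulIf d42); transitivity (N2 * a2 + N4 * a4 - (N2 + N4) * a2); first by ring.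
  by rewrite even_root even_sum /a2 /a4 /class_valency /dual_root /=; field.
have N3E : N3 = class_valency T 3.
  by move: odd_sum; rewrite N1E /class_valency /=; lra.
have N2E : N2 = class_valency T 2.
  by move: even_sum; rewrite N4E /class_valency /=; lra.
move=> [k lt_k]; rewrite -[Ordinal lt_k]inord_val /=.
by case: k lt_k => [|[|[|[|[|]]]]] // _; rewrite inordK.
Qed.

(** * Eigenmatrix and labelling for the given Krein array *)

Section FourClass.
Variables (K : rcfType) (X : finType) (S : assoc_scheme X 4) (t : nat).
Hypotheses (t_ge3 : (3 <= t)%N) (t_odd : odd t).
Variable s : K.
Local Notation T := (t%:R : K).
Hypothesis def_s : s = T ^+ 2 - T + 1.
Variables (E : 'I_5 -> 'M[K]_#|X|) (q : 'I_5 -> 'I_5 -> 'I_5 -> K).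
Hypothesis S_cometric : cometric_ordering S E q.
Hypothesis S_krein : krein_array q =
    ([:: (s + T) * (T - 1); s ^+ 2 / T; s * (T - 1) / T; 1],
     [:: 1; s * (T - 1) / T; s ^+ 2 / T; (s + T) * (T - 1)]).
Hypotheses
  (val1 : has_valency S (inord 1) ((t + 1) * (t ^ 2 + 1) %/ 2)%N)
  (val2 : has_valency S (inord 2) ((t - 1) * (t ^ 2 + 1) %/ 2)%N)
  (val3 : has_valency S (inord 3) (t ^ 2 * (t ^ 2 - 1) %/ 2)%N)
  (val4 : has_valency S (inord 4) (t ^ 2 * (t ^ 2 + 1) %/ 2)%N).

Lemma T_ge3 : 3 <= T. Proof. by rewrite ler_nat. Qed.

Lemma card_nbrs_class (j : 'I_5) x : #|nbrs S j x|%:R = class_valency T j.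
Proof.
rewrite -[j]inord_val; case: j => -[|[|[|[|[|]]]]] //= _.
- rewrite (_ : nbrs _ _ _ = [set x]) ?cards1 ?inordK //.
  apply/setP => y; rewrite !inE eq_sym -(srel_id S); congr (S _ x y).
  by apply: val_inj; rewrite /= inordK.
- rewrite val1 natr_half; last by rewrite oddM oddD t_odd.
  by rewrite /class_valency inordK //= natrM !natrD natrX.
- rewrite val2 natr_half; last by rewrite oddM oddB ?t_odd //; lia.
  by rewrite /class_valency inordK //= natrM natrD natrB ?natrX //; lia.
- rewrite val3 natr_half; last by rewrite oddM oddB ?oddX ?t_odd //= expn_gt0; lia.
  by rewrite /class_valency inordK //= natrM natrB ?natrX // expn_gt0; lia.
- rewrite val4 natr_half; last by rewrite oddM oddD oddX ?t_odd.
  by rewrite /class_valency inordK //= natrM natrD natrX.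
Qed.

Lemma card_four_class : #|X|%:R = (T + 1) * (T ^+ 3 + 1).
Proof.
have [x _] := colour_surj S ord0.
have := sum_colour S (fun=> 1%N) x; rewrite sum1_card => ->.
rewrite natr_sum; under eq_bigr do rewrite -mulr_natr mul1r natn card_nbrs_class.
rewrite sum_ord5 !inordK // /class_valency /=; lra.
Qed.

Variable u : 'I_5 -> 'I_5 -> K.
Hypothesis uE : dual_eigenvalues S E u.

Let E_ord : idempotent_ordering S E. Proof. by case: S_cometric. Qed.
Let qE : krein_parameters E q. Proof. by case: S_cometric. Qed.
Local Notation o k := (inord k : 'I_5).

Let q0 j k : (j < 5)%N -> (k < 5)%N -> (j.+1 < k)%N || (k.+1 < j)%N ->
  q (o 1) (o j) (o k) = 0.
Proof.
have [_ _ [tri _]] := S_cometric.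
have gt0 a b : (a < 5)%N -> (b < 5)%N -> (a.+1 < b)%N -> q (o 1) (o a) (o b) = 0.
  move=> a5 b5 lt_ab; apply/eqP; apply: contraLR lt_ab => /tri.
  by rewrite -leqNgt !inordK.
move=> j5 k5 /orP[|lt_kj]; first exact: gt0.
exact: (krein_eq0_sym E_ord uE qE (gt0 _ _ _ _ _)).
Qed.

(** This is [krein_product] with i = 1, where only neighbouring indices survive. The off-diagonal
    coefficients come from the array, the diagonal ones from [krein_sum]. *)
Let recursion j :
  let h := u (o 1) j in let m := (s + T) * (T - 1) in
  [/\ h * h = m + (m - 1 - s ^+ 2 / T) * h + s * (T - 1) / T * u (o 2) j,
    h * u (o 2) j = s ^+ 2 / T * h + (m - s * (T - 1) / T - s * (T - 1) / T) * u (o 2) j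
             + s ^+ 2 / T * u (o 3) j ,
    h * u (o 3) j = s * (T - 1) / T * u (o 2) j + (m - 1 - s ^+ 2 / T) * u (o 3) j
             + m * u (o 4) j ,
    h * u (o 4) j = u (o 3) j &
    u (o 1) ord0 = m].
Proof.
move=> h m; move: S_krein; rewrite /krein_array /= => -[b0 b1 b2 b3 c1 c2 c3 c4].
have zs := (
  q0 (j := 0) (k := 2) isT isT isT, q0 (j := 0) (k := 3) isT isT isT,
  q0 (j := 0) (k := 4) isT isT isT, q0 (j := 1) (k := 3) isT isT isT,
  q0 (j := 1) (k := 4) isT isT isT, q0 (j := 2) (k := 0) isT isT isT,
  q0 (j := 2) (k := 4) isT isT isT, q0 (j := 3) (k := 0) isT isT isT,
  q0 (j := 3) (k := 1) isT isT isT, q0 (j := 4) (k := 0) isT isT isT,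
  q0 (j := 4) (k := 1) isT isT isT, q0 (j := 4) (k := 2) isT isT isT).
have o0 : ord0 = o 0 by apply: val_inj; rewrite /= inordK.
have q00 : q (o 1) (o 0) (o 0) = 0.
  by rewrite -o0 (krein_right0 E_ord uE qE) -val_eqE /= inordK.
have sumq := krein_sum E_ord uE qE (o 1).
have := sumq (o 0); have := sumq (o 1); have := sumq (o 2); have := sumq (o 3).
have := sumq (o 4); rewrite !sum_ord5.
rewrite !zs.
rewrite b0 b1 b2 b3 c1 c2 c3 c4 q00.
move=> s4 s3 s2 s1 s0.
have prod i := krein_product uE qE (o 1) i j.
have := prod (o 1); have := prod (o 2); have := prod (o 3); have := prod (o 4).
rewrite !sum_ord5.
rewrite !zs.
rewrite b0 b1 b2 b3 c2 c3 c4.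
rewrite -o0 (dual_eigenvalue0 E_ord uE) -/h => p4 p3 p2 p1.
have m_def : u (o 1) ord0 = m by rewrite -s0 /m; ring.
rewrite m_def in s1 s2 s3 s4 *.
have q11 : q (o 1) (o 1) (o 1) = m - 1 - s ^+ 2 / T by lra.
have q22 : q (o 1) (o 2) (o 2) = m - s * (T - 1) / T - s * (T - 1) / T by lra.
have q33 : q (o 1) (o 3) (o 3) = m - 1 - s ^+ 2 / T by lra.
have q44 : q (o 1) (o 4) (o 4) = 0 by rewrite /m in s4 *; lra.
by rewrite p1 p2 p3 p4 q11 q22 q33 q44; split=> //; rewrite /m; ring.
Qed.

(** Each relation j gets a root index [kappa j]. The map is a permutation fixing 0, and the zero row
    sums determine the valency belonging to each root; since valencies are distinct, [kappa] is the
    identity. *)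
Lemma dual_root_label j :
  [/\ u (o 1) j = dual_root T j, u (o 4) j = (-1) ^+ j
    & u (o 3) j = dual_root T j * (-1) ^+ j].
Proof.
have T3 := T_ge3.
have /fin_all_exists[kappa Hk] : forall j, exists k : 'I_5,
    u (o 1) j = dual_root T k /\ u (o 4) j = (-1) ^+ k.
  move=> i; have [e1 e2 e3 e4 _] := recursion i.
  exact: (krein_recursion_roots T3 def_s erefl e1 e2 e3 e4).
have u3 i : u (o 3) i = dual_root T (kappa i) * (-1) ^+ kappa i.
  by have [_ _ _ <- _] := recursion i; have [-> ->] := Hk i.
have T0 : T != 0 by apply/negP => /eqP; lra.
have c2_neq0 : s * (T - 1) / T != 0.
  rewrite !mulf_neq0 ?invr_eq0 //; apply/negP => /eqP; [rewrite def_s; nra | lra].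
(* The root fixes the whole column of u: the value at 2 follows from the first recursion equation,
   as c*_2 is nonzero. *)
have kappa_inj : injective kappa.
  move=> i k eq_k; apply: (dual_eigenvalue_inj E_ord uE) => l.
  have eq1 : u (o 1) i = u (o 1) k by rewrite !(proj1 (Hk _)) eq_k.
  rewrite -[l]inord_val; case: l => -[|[|[|[|[|]]]]] //= _.
  - rewrite (_ : o 0 = ord0) ?(dual_eigenvalue0 E_ord uE) //.
    by apply: val_inj; rewrite /= inordK.
  - have [ei _ _ _ _] := recursion i; have [ek _ _ _ _] := recursion k.
    by apply: (mulfI c2_neq0); rewrite eq1 in ei; lra.
  - by rewrite !u3 eq_k.
  - by rewrite !(proj2 (Hk _)) eq_k.
(* On R_0 the value is m, which differs from the four other roots. *)
have kappa0 : kappa (o 0) = o 0.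
  have o0 : ord0 = o 0 by apply: val_inj; rewrite /= inordK.
  have [_ _ _ _] := recursion (o 0); rewrite o0 (proj1 (Hk _)) => m_def.
  rewrite -[LHS]inord_val; move: (ltn_ord (kappa (o 0))) m_def.
  have s2 : 0 < s by rewrite def_s; nra.
  case: (nat_of_ord _) => [|[|[|[|[|]]]]] // _; rewrite /dual_root /= def_s => e; exfalso.
  - nra.
  - nra.
  - suff : - (T ^+ 2 + 1) / T <= 0 by rewrite e; nra.
    by rewrite mulNr oppr_le0 divr_ge0 //; nra.
  - suff : (T - 1) ^+ 2 / T < T - 1 by rewrite e; nra.
    rewrite ltr_pdivrMr; nra.
have [g kg gk] := injF_bij kappa_inj.
have [x _] := colour_surj S ord0.
have val_sum (F : 'I_5 -> K) : \sum_(i < 5) class_valency T (g i) * F i =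
    \sum_(i < 5) class_valency T i * F (kappa i).
  by rewrite (reindex kappa) /=; [under eq_bigr do rewrite kg | exists g => ? _].
have usum i : i != ord0 -> \sum_(j < 5) class_valency T j * u i j = 0.
  move=> i0; rewrite -[RHS](dual_eigenvalue_sum E_ord uE x i0); apply: eq_bigr => k _.
  by rewrite -(card_nbrs_class k x) mulr_natl.
have o_neq0 k : (0 < k)%N -> (k < 5)%N -> o k != ord0.
  by move=> k0 k5; rewrite -val_eqE /= inordK // -lt0n.
(* [class_valency_solve] is applied to the valency of the relation [g k] carrying root k, where [g]
   inverts [kappa]. *)
have kappaE i : kappa i = i.
  apply: (class_valency_inj T3); rewrite /= -{2}[i]kg; symmetry.
  move: (kappa i); apply: class_valency_solve => //.
  - by rewrite -kappa0 kg inordK.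
  - have := val_sum (fun=> 1); under eq_bigr do rewrite mulr1.
    move=> ->; rewrite sum_ord5 !inordK // /class_valency /=; lra.
  - rewrite (val_sum (fun k : 'I_5 => dual_root T k)).
    rewrite -[RHS](usum (o 1) (o_neq0 1 isT isT)).
    by apply: eq_bigr => k _; rewrite (proj1 (Hk _)).
  - rewrite (val_sum (fun k : 'I_5 => (-1) ^+ k)).
    rewrite -[RHS](usum (o 4) (o_neq0 4 isT isT)).
    by apply: eq_bigr => k _; rewrite (proj2 (Hk _)).
  - rewrite (val_sum (fun k : 'I_5 => dual_root T k * (-1) ^+ k)).
    rewrite -[RHS](usum (o 3) (o_neq0 3 isT isT)).
    by apply: eq_bigr => k _; rewrite u3.
by split; rewrite ?u3 ?(proj1 (Hk _)) ?(proj2 (Hk _)) kappaE.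
Qed.

(** The entries e of |X| E_4 are signs, and idempotency says that the |X| signs e(x,z)e(z,y)e(x,y),
    over all z, sum to |X|. So each is 1. *)
Lemma odd_colour x y z :
  odd (colour S x y) = odd (colour S x z) (+) odd (colour S z y).
Proof.
apply/eqP.
pose e v w := u (o 4) (colour S v w) : K.
have eE v w : e v w = (-1) ^+ odd (colour S v w).
  by rewrite /e; have [_ -> _] := dual_root_label (colour S v w); rewrite signr_odd.
have e_sq v w : e v w * e v w = 1 by rewrite eE -expr2 sqrr_sign.
have : \sum_z (1 - e x z * e z y * e x y) = 0.
  rewrite sumrB -mulr_suml (dual_eigenvalue_mul E_ord uE) eqxx -mulrA e_sq.
  by rewrite mulr1 sumr_const subrr.
have sg v w z' : e v w * e w z' * e v z' = (-1) ^+ (odd (colour S v w)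
    (+) odd (colour S w z') (+) odd (colour S v z')).
  by rewrite !eE !signr_addb.
move/eqP; rewrite psumr_eq0 => [/allP/(_ z (mem_index_enum z)) /=|w _]; last first.
  by rewrite sg; case: (_ (+) _); rewrite /= ?expr0 ?expr1; lra.
rewrite sg; case: (odd _) (odd _) (odd _) => [] [] [] //=;
  rewrite ?expr0 ?expr1 => /eqP; lra.
Qed.

Local Notation gram := (@graph_gram K X (concurrent S) t).

(** The matrix is (t/s)|X|(E_3 + E_4), so its square is t|X|/s times itself; t^3+1 = (t+1)s gives
    the constant. *)
Lemma concurrent_gram_idempotent x y :
  \sum_z gram x z * gram z y = T * (T + 1) ^+ 2 * gram x y.
Proof.
have T3 := T_ge3.
have T0 : T != 0 by apply/negP => /eqP; lra.
have s0 : s != 0 by apply/negP => /eqP; rewrite def_s; nra.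
have gramE v w : gram v w = T / s * (u (o 4) (colour S v w) + u (o 3) (colour S v w)).
  rewrite /graph_gram /concurrent !srelE -(colour_eq0 S).
  have [_ -> ->] := dual_root_label (colour S v w).
  rewrite -!val_eqE /= !inordK //.
  rewrite def_s in s0 *.
  case: (colour S v w) => -[|[|[|[|[|]]]]] //= _; rewrite /dual_root /=;
    by field; rewrite ?s0 ?T0.
pose c : K := T / s.
pose w i j z := u (o i) (colour S x z) * u (o j) (colour S z y).
transitivity (\sum_z c ^+ 2 * (w 4 4 z + w 4 3 z + w 3 4 z + w 3 3 z)).
  by apply: eq_bigr => z _; rewrite !gramE -/c /w; ring.
rewrite -mulr_sumr !big_split /= !(dual_eigenvalue_mul E_ord uE) !eqxx.
rewrite -!(inj_eq val_inj) /= !inordK //= card_four_class gramE /c def_s.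
by rewrite def_s in s0; field.
Qed.

Lemma card_four_class_nat : #|X| = ((t + 1) * (t ^ 3 + 1))%N.
Proof.
apply/eqP; rewrite -(eqr_nat K) card_four_class.
by rewrite natrM !natrD natrX.
Qed.

Lemma concurrent_valency x : #|[set y | concurrent S x y]| = (t * (t ^ 2 + 1))%N.
Proof.
have -> : [set y | concurrent S x y] = nbrs S (o 1) x :|: nbrs S (o 2) x.
  by apply/setP => y; rewrite !inE.
rewrite cardsU (_ : _ :&: _ = set0) ?cards0 ?subn0; last first.
  apply/setP => y; rewrite !inE !srelE; case: eqP => //= ->.
  by rewrite -val_eqE /= !inordK.
apply/eqP; rewrite -(eqr_nat K) natrD !card_nbrs_class !inordK //.
rewrite natrM natrD natrX /class_valency /=; apply/eqP; lra.
Qed.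

End FourClass.

Theorem theorem4p1 (K : rcfType) (X : finType) (S : assoc_scheme X 4)
  (t : nat) (t_ge3 : (3 <= t)%N) (t_odd : odd t)
  (s : K) (def_s : s = t%:R ^+ 2 - t%:R + 1)
  (E : 'I_5 -> 'M[K]_#|X|) (q : 'I_5 -> 'I_5 -> 'I_5 -> K)
  (S_cometric : cometric_ordering S E q)
  (S_krein : krein_array q =
    ([:: (s + t%:R) * (t%:R - 1); s ^+ 2 / t%:R; s * (t%:R - 1) / t%:R; 1],
     [:: 1; s * (t%:R - 1) / t%:R; s ^+ 2 / t%:R; (s + t%:R) * (t%:R - 1)]))
  (val1 : has_valency S (inord 1) ((t + 1) * (t ^ 2 + 1) %/ 2)%N)
  (val2 : has_valency S (inord 2) ((t - 1) * (t ^ 2 + 1) %/ 2)%N)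
  (val3 : has_valency S (inord 3) (t ^ 2 * (t ^ 2 - 1) %/ 2)%N)
  (val4 : has_valency S (inord 4) (t ^ 2 * (t ^ 2 + 1) %/ 2)%N) :
  is_GQ (@Cinc X S) (t ^ 2) t /\
  forall x : X,
    is_hemisystem (@Cinc X S) t
      ([set x] :|: nbrs S (inord 2) x :|: nbrs S (inord 4) x).
Proof.
have [E_ord _ _] := S_cometric; have [u uE] := dual_eigenvalues_exist E_ord.
have cardX := card_four_class_nat K t_ge3 t_odd val1 val2 val3 val4.
have g_reg := concurrent_valency K t_ge3 t_odd val1 val2 val3 val4.
have parity := odd_colour t_ge3 t_odd def_s S_cometric S_krein val1 val2 val3 val4 uE.
have idem := concurrent_gram_idempotent
  t_ge3 t_odd def_s S_cometric S_krein val1 val2 val3 val4 uE.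
have g_sym := concurrent_sym S; have g_irr := concurrent_irr S.
have common2 := card_common_nbrs t_ge3 g_sym g_irr cardX g_reg idem.
have common3 := card_common_nbrs3 t_ge3 g_sym g_irr cardX g_reg idem.
split; first exact: Cinc_GQ.
by move=> x; apply: Cinc_hemisystem.
Qed.
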